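(* In the permutation model for random binary search trees, let $v_1,\dots,v_{n+1}$ be the external nodes as discovered by the depth first search process from left to right, and let $D_k^*(n)$ and $W_k^*(n)$ be the depth and weighted depth of $v_k$, $1\le k\le n+1$. Then, as $n\to\infty$, uniformly in $1\le k\le n$, $$\mathbf E\big[|D_k(n)-D_k^*(n)|^2\big]=o(\log n),\qquad \mathbf E\big[|W_k(n)-W_k^*(n)|^2\big]=o\big(\mathrm{Var}(W_k(n))\big).$$
   Context: Binary search tree: given a list of distinct elements of a totally ordered set, the binary search tree is the labelled rooted binary tree with one node per element, obtained by successively inserting the elements in the order of the list, so that for every node with label (key) $y$ all keys in its left subtree are at most $y$ and all keys in its right subtree are strictly larger than $y$. Permutation model: the list is a uniformly random permutation of $\{1,\dots,n\}$. Notation: $D_k(n)$ is the depth (graph distance to the root) of the node labelled $k$, for $1\le k\le n$. $W_k(n)$ is its weighted depth, i.e. the sum of all labels on the path from the root to the node labelled $k$, labels of both endpoints included. External nodes: embed the tree in the complete infinite binary tree; a node of the infinite tree is external if its graph distance to the (finite) binary tree is one. A tree with $n$ nodes has $n+1$ external nodes. The depth of an external node is its graph distance to the root; external nodes carry no label, and the weighted depth of an external node is the sum of all labels of the tree nodes on the path from the root to it. *)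

(* Defs.v *)
From mathcomp Require Import all_boot all_order all_fingroup all_algebra.
From mathcomp Require Import all_classical all_reals all_analysis.

Set Implicit Arguments.
Unset Strict Implicit.
Unset Printing Implicit Defensive.

Import Order.TTheory GRing.Theory Num.Theory.

Local Open Scope nat_scope.

(* Addresses in the complete infinite binary tree: the sequence of moves from
   the root [::], with false = left child and true = right child.  The graph
   distance of an address to the root is its size. *)
Definition addr := seq bool.

Definition neighbours (p : addr) : seq addr :=
  (if p is [::] then [::] else [:: take (size p).-1 p])
    ++ [:: rcons p false; rcons p true].

Inductive btree := Leaf | Node of btree & nat & btree.

Fixpoint insert (x : nat) (t : btree) : btree :=
  match t with
  | Leaf => Node Leaf x Leaf
  | Node l y r => if x <= y then Node (insert x l) y r
                  else Node l y (insert x r)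
  end.

Definition bst (s : seq nat) : btree := foldl (fun t x => insert x t) Leaf s.

(* None when the address is not a node of the finite tree. *)
Fixpoint label_at (t : btree) (p : addr) : option nat :=
  match t, p with
  | Leaf, _ => None
  | Node _ y _, [::] => Some y
  | Node l _ r, b :: q => label_at (if b then r else l) q
  end.

Definition is_node (t : btree) (p : addr) : bool := isSome (label_at t p).

Definition is_external (t : btree) (p : addr) : bool :=
  ~~ is_node t p && has (is_node t) (neighbours p).

(* Left-to-right depth first search of the infinite tree, not going below an
   address outside the finite tree; addresses in order of discovery. *)
Fixpoint dfs (t : btree) : seq addr :=
  match t with
  | Leaf => [:: [::]]
  | Node l _ r => [::] :: map (cons false) (dfs l) ++ map (cons true) (dfs r)
  end.

Definition external_nodes (t : btree) : seq addr :=
  [seq p <- dfs t | is_external t p].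

Definition node_of_label (t : btree) (k : nat) : addr :=
  nth [::] (dfs t) (find (fun p => label_at t p == Some k) (dfs t)).

(* The external node v_k, counted from k = 1. *)
Definition external_node (t : btree) (k : nat) : addr :=
  nth [::] (external_nodes t) k.-1.

Definition depth (p : addr) : nat := size p.

(* Both endpoints of the path are included; an external endpoint contributes 0
   because it has no label. *)
Definition wdepth (t : btree) (p : addr) : nat :=
  \sum_(i < (size p).+1) odflt 0 (label_at t (take i p)).

(* 'S_n permutes {0, ..., n-1}: shift to a list of 1, ..., n. *)
Definition keys (n : nat) (s : 'S_n) : seq nat :=
  [seq (nat_of_ord (s i)).+1 | i <- enum 'I_n].

Definition Dnode (n k : nat) (s : 'S_n) : nat :=
  depth (node_of_label (bst (keys s)) k).
Definition Wnode (n k : nat) (s : 'S_n) : nat :=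
  wdepth (bst (keys s)) (node_of_label (bst (keys s)) k).
Definition Dext (n k : nat) (s : 'S_n) : nat :=
  depth (external_node (bst (keys s)) k).
Definition Wext (n k : nat) (s : 'S_n) : nat :=
  wdepth (bst (keys s)) (external_node (bst (keys s)) k).

Local Open Scope ring_scope.

(* Expectation and variance under the uniform distribution on 'S_n. *)
Definition Eperm (R : realType) (n : nat) (X : 'S_n -> R) : R :=
  (\sum_(s : 'S_n) X s) / #|{: 'S_n}|%:R.

Definition Varperm (R : realType) (n : nat) (X : 'S_n -> R) : R :=
  Eperm (fun s => (X s - Eperm X) ^+ 2).

(* f n k = o(g n k) as n tends to infinity, uniformly in 1 <= k <= n. *)
Definition unif_littleo (R : realType) (f g : nat -> nat -> R) : Prop :=
  forall eps : R, 0 < eps -> exists N : nat, forall n k : nat,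
    (N <= n)%N -> (1 <= k <= n)%N -> `|f n k| <= eps * `|g n k|.

Local Open Scope nat_scope.

(* Sanity checks: each label 1, ..., n sits at exactly one address, and the
   search discovers exactly the external nodes, once each. *)
Fixpoint tkeys (t : btree) : seq nat :=
  if t is Node l y r then tkeys l ++ y :: tkeys r else [::].

Lemma tkeys_insert x t : perm_eq (tkeys (insert x t)) (x :: tkeys t).
Proof.
elim: t => [|l IHl y r IHr] //=; case: ifP => _ /=.
  by rewrite -cat_cons perm_cat2r.
rewrite perm_sym -cat1s perm_catCA /= perm_cat2l perm_sym -cat1s.
by rewrite -[y :: tkeys r]cat1s perm_sym (perm_catCA [:: x] [:: y]) perm_cons perm_sym.
Qed.

Lemma tkeys_bst s : perm_eq (tkeys (bst s)) s.
Proof.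
elim/last_ind: s => // s x IHs; rewrite /bst foldl_rcons -/(bst s).
by rewrite (perm_trans (tkeys_insert _ _)) // perm_sym perm_rcons perm_cons perm_sym.
Qed.

Lemma keys_perm n (s : 'S_n) : perm_eq (keys s) (iota 1 n).
Proof.
apply: uniq_perm; rewrite ?iota_uniq //.
  by rewrite map_inj_uniq ?enum_uniq // => i j [] /val_inj/perm_inj.
move=> x; rewrite mem_iota add1n ltnS; apply/mapP/idP => [[i _ ->]|].
  by rewrite ltn_ord.
case: x => // x /= lt_xn; exists ((s^-1)%g (Ordinal lt_xn)).
  by rewrite mem_enum.
by rewrite permKV.
Qed.

Lemma mem_cons_dfs b c (s : seq addr) p :
  (b :: p \in map (cons c) s) = (b == c) && (p \in s).
Proof.
apply/mapP/andP => [[q qs [-> ->]]|[/eqP -> ps]]; first by rewrite eqxx.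
by exists p.
Qed.

Lemma nil_cons_dfs b (s : seq addr) : ([::] \in map (cons b) s) = false.
Proof. by apply/mapP => -[]. Qed.

Lemma nil_dfs t : [::] \in dfs t.
Proof. by case: t. Qed.

Lemma cons_dfs l y r b p :
  (b :: p \in dfs (Node l y r)) = (p \in dfs (if b then r else l)).
Proof. by rewrite /= in_cons mem_cat !mem_cons_dfs; case: b; rewrite ?orbF. Qed.

Lemma dfs_uniq t : uniq (dfs t).
Proof.
elim: t => //= l IHl y r IHr; rewrite mem_cat !nil_cons_dfs cat_uniq.
rewrite !map_inj_uniq ?IHl ?IHr ?andbT; try by move=> p q [].
by apply/hasP => -[_ /mapP[p _ ->]]; rewrite mem_cons_dfs.
Qed.

Lemma node_dfs t p : is_node t p -> p \in dfs t.
Proof.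
elim: t p => [|l IHl y r IHr] [|b p] //; rewrite cons_dfs.
by case: b => [/IHr|/IHl].
Qed.

Lemma child_dfs t p b : is_node t p -> rcons p b \in dfs t.
Proof.
elim: t p => [|l IHl y r IHr] [|c p] //.
  by rewrite cons_dfs nil_dfs.
rewrite rcons_cons cons_dfs.
by case: c => [/IHr|/IHl].
Qed.

Lemma node_parent t p b : is_node t (rcons p b) -> is_node t p.
Proof.
by elim: t p => [|l IHl y r IHr] [|c p] //; case: c => [/IHr|/IHl].
Qed.

Lemma mem_external_nodes t p : (p \in external_nodes t) = is_external t p.
Proof.
rewrite mem_filter andb_idr // => /andP[npt /hasP[q]].
rewrite mem_cat !inE => /orP[|/orP[/eqP->|/eqP->] /node_parent]; last 2 first.
- by rewrite (negPf npt).
- by rewrite (negPf npt).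
case/lastP: p {npt} => // p b; rewrite size_rcons /=.
have -> : take (size p) (rcons p b) = p by rewrite -cats1 take_size_cat.
case E: (rcons p b) => [|c r]; first by case: (p) E.
by rewrite inE -E => /eqP-> /(child_dfs b).
Qed.

Lemma external_nodes_uniq t : uniq (external_nodes t).
Proof. exact/filter_uniq/dfs_uniq. Qed.

Lemma label_at_mem t p k : label_at t p = Some k -> k \in tkeys t.
Proof.
elim: t p => [|l IHl y r IHr] [|b p] //=.
  by case=> ->; rewrite mem_cat inE eqxx orbT.
by case: b => [/IHr|/IHl] h; rewrite mem_cat ?in_cons h ?orbT.
Qed.

Lemma mem_label_at t k : k \in tkeys t -> exists p, label_at t p = Some k.
Proof.
elim: t => //= l IHl y r IHr; rewrite mem_cat in_cons.
case/or3P => [/IHl[p]|/eqP->|/IHr[p]].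
- by exists (false :: p).
- by exists [::].
- by exists (true :: p).
Qed.

Lemma label_at_inj t p q k : uniq (tkeys t) ->
  label_at t p = Some k -> label_at t q = Some k -> p = q.
Proof.
elim: t p q => [|l IHl y r IHr] p q //=; rewrite cat_uniq /=.
case/and4P => ul; rewrite negb_or => /andP[yl /hasPn rl] yr ur.
case: p q => [|b p] [|c q] //=.
- by case=> <-; case: c => /label_at_mem; rewrite ?(negPf yl) ?(negPf yr).
- move=> + [E]; rewrite -{}E.
  by case: b => /label_at_mem; rewrite ?(negPf yl) ?(negPf yr).
case: b; case: c => hp hq.
- by rewrite (IHr p q).
- by have /rl/negP[] := label_at_mem hp; exact: label_at_mem hq.
- by have /rl/negP[] := label_at_mem hq; exact: label_at_mem hp.
- by rewrite (IHl p q).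
Qed.

Lemma node_of_labelP n (s : 'S_n) k p : 1 <= k <= n ->
  (label_at (bst (keys s)) p == Some k) = (p == node_of_label (bst (keys s)) k).
Proof.
move=> kn; set t := bst _.
have pk : perm_eq (tkeys t) (iota 1 n) := perm_trans (tkeys_bst _) (keys_perm s).
have ut : uniq (tkeys t) by rewrite (perm_uniq pk) iota_uniq.
have [q hq] : exists q, label_at t q = Some k.
  by apply: mem_label_at; rewrite (perm_mem pk) mem_iota add1n ltnS.
have hn : label_at t (node_of_label t k) == Some k.
  apply: (@nth_find _ [::] (fun p => label_at t p == Some k)).
  apply/hasP; exists q; rewrite ?hq //.
  by apply: node_dfs; rewrite /is_node hq.
apply/eqP/eqP => [hp|->]; last exact/eqP.
exact: label_at_inj ut hp (eqP hn).
Qed.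

(* Main.v *)
Require Import Defs.
From mathcomp Require Import all_boot all_order all_fingroup all_algebra.
From mathcomp Require Import all_classical all_reals all_analysis.
From mathcomp Require Import zify ring lra.

Set Implicit Arguments.
Unset Strict Implicit.
Unset Printing Implicit Defensive.

Import Order.TTheory GRing.Theory Num.Theory.
Local Open Scope nat_scope.

(** The external node v_k is reached from the node labelled k by one step to
the left followed by steps to the right until leaving the tree.  Hence the two
depths differ by 1 + X, and the two weighted depths by at most k X, where X is
the number of nodes on the right spine of the left subtree of k
([Dext_sub_Dnode], [Wext_sub_Wnode]).

Everything about a binary search tree is expressed through the order in which
the keys are inserted: j is an ancestor of k (or k itself) if and only if j
comes first among the keys between j and k ([key_pathE]), and similarly for
the gap just below k ([gap_pathE]).  In particular j < k lies on the spine
counted by X if and only if k comes first in [j, k] and j comes first in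
[j, k-1].  The probabilities of such events follow from a single symmetry
argument: conditionally on an event that is invariant under the exchange of
any two keys of an interval, each key of that interval is equally likely to
come first ([prob_first]).

At distances d < e from k, the probabilities that k - e is on the spine, and
that k - d and k - e both are, are 1/(e(e+1)) and at most 1/(d e(e+1)).  The
resulting bound on the second moment of X telescopes to 3 - (3 + 2 H_m)/(m + 1)
for the contribution of the distances up to m ([spine_count_moment]), H_m being
the m-th harmonic number.  So E[(1 + X)^2] <= 8, which is o(log n), and the
second moment of the difference of the weighted depths is at most 3 k^2.

It remains to see that k^2 is negligible with respect to Var(W_k).  The
weighted depth is the sum of j over the ancestors j of k, and the ancestor
indicators are pairwise nonnegatively correlated ([prob_anc_pair]), so that the
variance is at least the sum of the variances of the single terms
([Varperm_sum_ge]).  The indicator at distance b has variance b/(b+1)^2, and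
on at least one side of k there are n/4 keys that are at least k/2; hence the
variance is at least k^2/8 times a partial sum of the harmonic series with n/4
terms ([Var_anc_ge]), and the harmonic series diverges. *)

(** * Paths in a binary search tree *)

Lemma bst_cons x s :
  bst (x :: s) = Node (bst [seq z <- s | z <= x]) x (bst [seq z <- s | ~~ (z <= x)]).
Proof.
rewrite /bst /=.
have gen l r : foldl (fun t z => insert z t) (Node l x r) s =
   Node (foldl (fun t z => insert z t) l [seq z <- s | z <= x]) x
        (foldl (fun t z => insert z t) r [seq z <- s | ~~ (z <= x)]).
  by elim: s l r => //= z s IHs l r; case: ifP => _; rewrite IHs.
by rewrite gen.
Qed.

(** Induction along the recursive decomposition given by [bst_cons]. *)
Lemma bst_ind_list (P : seq nat -> Prop) : P [::] ->
  (forall x s, P [seq z <- s | z <= x] -> P [seq z <- s | ~~ (z <= x)] ->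
     P (x :: s)) -> forall s, P s.
Proof.
move=> P0 Pc s; have [m] := ubnP (size s); elim: m s => // m IHm [|x s] //= sm.
by apply: Pc; apply: IHm; rewrite size_filter; apply: leq_ltn_trans (count_size _ _) _.
Qed.

(** The address at which the search for the key [k] stops; when [k] is not in
the tree this is the address where [insert] would add it. *)
Fixpoint key_addr (k : nat) (t : btree) : addr :=
  match t with
  | Leaf => [::]
  | Node l y r => if y == k then [::]
                  else if k <= y then false :: key_addr k l
                  else true :: key_addr k r
  end.

(** The address outside the tree at which the search for the gap just below
[k] stops: the search goes to the left of [k] if it meets it. *)
Fixpoint gap_addr (k : nat) (t : btree) : addr :=
  match t with
  | Leaf => [::]
  | Node l y r => if k <= y then false :: gap_addr k l else true :: gap_addr k r
  end.

(** The labels met from the root to the address [p], both ends included. *)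
Fixpoint path_labels (t : btree) (p : addr) : seq nat :=
  match t, p with
  | Leaf, _ => [::]
  | Node _ y _, [::] => [:: y]
  | Node l y r, b :: q => y :: path_labels (if b then r else l) q
  end.

Lemma label_key_addr k s : k \in s -> label_at (bst s) (key_addr k (bst s)) = Some k.
Proof.
elim/bst_ind_list: s => // x s IHl IHr; rewrite in_cons bst_cons /=.
case: (eqVneq x k) => [->//|xk]; rewrite /= => ks.
case: ifP => kx /=; first by apply: IHl; rewrite mem_filter kx.
by apply: IHr; rewrite mem_filter kx.
Qed.

Lemma wdepth_path_labels t p : wdepth t p = sumn (path_labels t p).
Proof.
rewrite /wdepth; elim: t p => [|l IHl y r IHr] p.
  by rewrite big1 //= => i _; case: take.
case: p => [|b p] /=; first by rewrite big_ord_recl big_ord0 /=.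
by rewrite big_ord_recl /=; case: b; rewrite -?IHl -?IHr.
Qed.

Lemma size_gap_path k t : size (path_labels t (gap_addr k t)) = size (gap_addr k t).
Proof. by elim: t => //= l IHl y r IHr; case: ifP => _ /=; rewrite ?IHl ?IHr. Qed.

Lemma size_key_path k s : k \in s ->
  size (path_labels (bst s) (key_addr k (bst s))) = (size (key_addr k (bst s))).+1.
Proof.
elim/bst_ind_list: s => // x s IHl IHr; rewrite in_cons bst_cons /=.
case: (eqVneq x k) => [->//|xk]; rewrite /= => ks.
case: ifP => kx /=; first by rewrite IHl // mem_filter kx.
by rewrite IHr // mem_filter kx.
Qed.

(** The addresses just outside the tree, from left to right.  For a nonempty
tree these are the external nodes; for the empty tree [leaves] contains the
root address, while [external_nodes] is empty. *)
Definition leaves (t : btree) : seq addr := [seq p <- Defs.dfs t | ~~ is_node t p].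

Lemma leaves_Node l y r :
  leaves (Node l y r) = map (cons false) (leaves l) ++ map (cons true) (leaves r).
Proof. by rewrite /leaves /= filter_cat !filter_map. Qed.

Lemma size_leaves t : size (leaves t) = (size (tkeys t)).+1.
Proof.
elim: t => // l IHl y r IHr.
by rewrite leaves_Node size_cat !size_map IHl IHr /= size_cat /=; lia.
Qed.

Lemma dfs_parent t p b : rcons p b \in Defs.dfs t -> is_node t p.
Proof.
elim: t p => [|l IHl y r IHr] [|c p] //; rewrite rcons_cons cons_dfs.
by case: c => [/IHr|/IHl].
Qed.

Lemma external_nodes_leaves t : t <> Leaf -> external_nodes t = leaves t.
Proof.
move=> tN; apply: eq_in_filter => p pt; rewrite /is_external.
case: (boolP (is_node t p)) => //= npt.
case/lastP: p pt npt => [|p b] pt npt; first by case: t tN npt {pt}.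
apply/hasP; exists p; last exact: dfs_parent pt.
rewrite /neighbours mem_cat; apply/orP; left.
case E: (rcons p b) => [|c r]; first by case: (p) E.
by rewrite -E inE size_rcons /= -cats1 take_size_cat.
Qed.

Lemma size_bst s : size (tkeys (bst s)) = size s.
Proof. exact/perm_size/tkeys_bst. Qed.

(** The leaf at which the search for the gap below [k] stops is preceded by
exactly as many leaves as there are keys less than [k]. *)
Lemma nth_leaves k s : uniq s ->
  nth [::] (leaves (bst s)) (count (fun x => x < k) s) = gap_addr k (bst s).
Proof.
elim/bst_ind_list: s => // x s IHl IHr /= /andP[xs us].
rewrite bst_cons leaves_Node /= nth_cat size_map size_leaves size_bst.
have cE : count (fun y => y < k) s = count (fun y => y < k) [seq z <- s | z <= x]
           + count (fun y => y < k) [seq z <- s | ~~ (z <= x)].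
  rewrite -count_cat; apply/seq.permP; rewrite perm_sym.
  exact/permPl/(perm_filterC (fun z => z <= x)).
rewrite cE; case: (leqP k x) => kx /=.
  rewrite add0n [X in _ + X](_ : _ = 0) ?addn0; last first.
    by apply/eqP; rewrite -leqn0 leqNgt -has_count -all_predC; apply/allP => z;
       rewrite mem_filter /= => /andP[zx _]; lia.
  rewrite ltnS count_size.
  by rewrite (nth_map [::]) ?IHl ?filter_uniq // size_leaves size_bst ltnS count_size.
rewrite [X in _ + (X + _)](_ : _ = size [seq z <- s | z <= x]); last first.
  apply/eqP; rewrite -all_count; apply/allP => z.
  by rewrite mem_filter /= => /andP[zx _]; lia.
rewrite add1n -addSn ltnNge leq_addr /= addKn.
by rewrite (nth_map [::]) ?IHr ?filter_uniq // size_leaves size_bst ltnS count_size.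
Qed.

(** * Ancestors and the order of insertion *)

(** The element of [a, b] that comes first in the list [s], if any. *)
Definition first (a b : nat) (s : seq nat) : option nat :=
  ohead [seq x <- s | a <= x <= b].

Lemma first_cons a b x s :
  first a b (x :: s) = if a <= x <= b then Some x else first a b s.
Proof. by rewrite /first /=; case: ifP. Qed.

Lemma first_filter (p : pred nat) a b s :
  (forall x, a <= x <= b -> p x) -> first a b [seq x <- s | p x] = first a b s.
Proof.
move=> abp; rewrite /first -filter_predI; congr ohead; apply: eq_filter => x /=.
by case: (boolP (a <= x <= b)) => // /abp ->.
Qed.

(** In the tree built from [s], the key [j] is an ancestor of the key [k], or
[k] itself. *)
Definition anc (k j : nat) (s : seq nat) : bool :=
  first (minn j k) (maxn j k) s == Some j.

(** In the tree built from [s], the key [j] lies on the path to the gap just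
below [k]. *)
Definition gap_anc (k j : nat) (s : seq nat) : bool :=
  if k <= j then first k j s == Some j else first j k.-1 s == Some j.

Lemma key_pathE k s : uniq s -> k \in s ->
  path_labels (bst s) (key_addr k (bst s)) = [seq j <- s | anc k j s].
Proof.
elim/bst_ind_list: s => // x s IHl IHr /= /andP[xs us].
have xj j : j \in s -> x != j by move=> js; apply: contraNneq xs => ->.
have eSome j : j \in s -> (Some x == Some j) = false.
  by move=> /xj/negPf; apply: contraFF => /eqP[->].
rewrite /anc first_cons geq_minl leq_maxl eqxx in_cons bst_cons /=.
case: (eqVneq x k) => [<- _|xk].
  rewrite (eq_in_filter (a2 := pred0)) ?filter_pred0 // => j js.
  by rewrite first_cons geq_minr leq_maxr /= eSome.
rewrite /= => ks.
case: ifP => kx /=; congr (_ :: _).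
  rewrite IHl ?filter_uniq ?mem_filter ?kx // -filter_predI.
  apply: eq_in_filter => j js /=; rewrite /anc first_cons.
  have := xj _ js => xnj; case: (leqP j x) => jx /=.
    rewrite andbT ifF; last by apply/negP; lia.
    by rewrite first_filter // => z; lia.
  by rewrite andbF ifT ?eSome //; lia.
rewrite IHr ?filter_uniq ?mem_filter ?kx // -filter_predI.
apply: eq_in_filter => j js /=; rewrite /anc first_cons.
have := xj _ js => xnj; case: (leqP j x) => jx /=.
  by rewrite andbF ifT ?eSome //; lia.
rewrite andbT ifF; last by apply/negP; lia.
by rewrite first_filter // => z; lia.
Qed.

Lemma gap_pathE k s : uniq s ->
  path_labels (bst s) (gap_addr k (bst s)) = [seq j <- s | gap_anc k j s].
Proof.
elim/bst_ind_list: s => // x s IHl IHr /= /andP[xs us].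
have xj j : j \in s -> x != j by move=> js; apply: contraNneq xs => ->.
have eSome j : j \in s -> (Some x == Some j) = false.
  by move=> /xj/negPf; apply: contraFF => /eqP[->].
rewrite bst_cons /= {1}/gap_anc !first_cons.
have -> : (if k <= x then (if k <= x <= x then Some x else first k x s) == Some x
   else (if x <= x <= k.-1 then Some x else first x k.-1 s) == Some x) = true.
  by case: leqP => kx; rewrite ifT ?eqxx //; lia.
case: ifP => kx /=; congr (_ :: _).
  rewrite IHl ?filter_uniq // -filter_predI.
  apply: eq_in_filter => j js /=; rewrite /gap_anc !first_cons.
  have := xj _ js => xnj; case: (leqP j x) => jx /=.
    rewrite andbT; have -> : (k <= x <= j) = false by lia.
    have -> : (x <= k.-1) = false by lia.
    by rewrite !first_filter // => z; lia.
  by rewrite andbF ifT; [rewrite ifT ?eSome //|]; lia.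
rewrite IHr ?filter_uniq // -filter_predI.
apply: eq_in_filter => j js /=; rewrite /gap_anc !first_cons.
have := xj _ js => xnj; case: (leqP j x) => jx /=.
  by rewrite andbF ifF; [rewrite ifT ?eSome //|]; lia.
rewrite andbT; have -> : (k <= x <= j) = false by lia.
by case: (leqP k j) => kj; rewrite !first_filter // => z; lia.
Qed.

(** The intervals [j, k] and [j, k-1] differ at most by [k]. *)
Lemma first_last j k s :
  first j k s = Some k \/ first j k s = first j k.-1 s.
Proof.
elim: s => [|x s IHs]; first by right.
rewrite !first_cons; case: (eqVneq x k) => [->|xk]; last first.
  have -> : (j <= x <= k.-1) = (j <= x <= k) by lia.
  by case: ifP => _ //; right.
case: ifP => [_|jk]; first by left.
by rewrite ifF //; move: jk; lia.
Qed.

(** For [j < k]: in the tree built from [s], the key [j] lies on the right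
spine of the left subtree of [k].  Indeed [k] is then an ancestor of [j], and
[j] an ancestor of the gap just below [k]. *)
Definition spine (k j : nat) (s : seq nat) : bool :=
  (first j k s == Some k) && (first j k.-1 s == Some j).

Lemma gap_ancE k j s :
  nat_of_bool (gap_anc k j s) = anc k j s + ((j < k) && spine k j s).
Proof.
rewrite /gap_anc /anc /spine; case: (leqP k j) => kj /=.
  by rewrite addn0.
have eqS (a b : nat) : (Some a == Some b) = (a == b).
  by apply/eqP/eqP => [[]|->].
case: (first_last j k s) => ->; rewrite ?eqxx /=.
  by rewrite eqS (gtn_eqF kj).
case: (eqVneq (first j k.-1 s) (Some j)) => [->|_] /=; last by rewrite andbF.
by rewrite eqS (ltn_eqF kj).
Qed.

(** * Depths as sums over ancestors *)

Section Keys.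
Variables (n k : nat).
Implicit Type s : 'S_n.

Lemma keys_uniq s : uniq (keys s).
Proof. by rewrite (perm_uniq (keys_perm s)) iota_uniq. Qed.

Lemma mem_keys s j : (j \in keys s) = (1 <= j <= n).
Proof. by rewrite (perm_mem (keys_perm s)) mem_iota add1n ltnS. Qed.

Lemma sum_keys s (P : pred nat) (f : nat -> nat) :
  \sum_(j <- [seq j <- keys s | P j]) f j = \sum_(1 <= j < n.+1 | P j) f j.
Proof.
by rewrite big_filter (perm_big _ (keys_perm s)) /index_iota subSS subn0.
Qed.

Hypothesis kn : 1 <= k <= n.

Lemma node_of_labelE s : node_of_label (bst (keys s)) k = key_addr k (bst (keys s)).
Proof.
apply/esym/eqP; rewrite -node_of_labelP //; apply/eqP/label_key_addr.
by rewrite mem_keys.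
Qed.

Lemma external_nodeE s : external_node (bst (keys s)) k = gap_addr k (bst (keys s)).
Proof.
rewrite /external_node external_nodes_leaves; last first.
  move/(congr1 (size \o tkeys)); rewrite /= size_bst (perm_size (keys_perm s)).
  by rewrite size_iota => n0; move: kn; rewrite n0; lia.
rewrite -nth_leaves ?keys_uniq //; congr nth.
rewrite (seq.permP (keys_perm s)) /=.
have -> : n = k.-1 + (n - k.-1) by lia.
rewrite iotaD count_cat [X in X + _](_ : _ = k.-1); last first.
  rewrite -[RHS](size_iota 1); apply/eqP; rewrite -all_count.
  by apply/allP => j; rewrite mem_iota /=; lia.
rewrite [X in _ + X](_ : _ = 0) ?addn0 //.
apply/eqP; rewrite -leqn0 leqNgt -has_count -all_predC.
by apply/allP => j; rewrite mem_iota /=; lia.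
Qed.

Lemma WnodeE s : Wnode k s = \sum_(1 <= j < n.+1 | anc k j (keys s)) j.
Proof.
rewrite /Wnode node_of_labelE wdepth_path_labels key_pathE ?keys_uniq ?mem_keys //.
by rewrite sumnE (sum_keys s).
Qed.

Lemma DnodeE s : (Dnode k s).+1 = \sum_(1 <= j < n.+1 | anc k j (keys s)) 1.
Proof.
rewrite /Dnode /depth node_of_labelE -size_key_path ?mem_keys //.
by rewrite key_pathE ?keys_uniq ?mem_keys // -sum1_size (sum_keys s).
Qed.

Lemma sum_gap_anc s (f : nat -> nat) :
  \sum_(1 <= j < n.+1 | gap_anc k j (keys s)) f j =
  \sum_(1 <= j < n.+1 | anc k j (keys s)) f j +
  \sum_(1 <= j < k | spine k j (keys s)) f j.
Proof.
rewrite (@big_nat_widen _ _ _ 1 k n.+1); last by lia.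
rewrite big_mkcond [X in _ = X + _]big_mkcond [X in _ = _ + X]big_mkcond.
rewrite -big_split; apply: eq_bigr => j _ /=.
have := gap_ancE k j (keys s).
by case: gap_anc; case: anc; case: spine; case: (j < k) => //=; rewrite ?addn0.
Qed.

Lemma WextE s : Wext k s = Wnode k s + \sum_(1 <= j < k | spine k j (keys s)) j.
Proof.
rewrite /Wext external_nodeE wdepth_path_labels gap_pathE ?keys_uniq //.
by rewrite sumnE (sum_keys s) sum_gap_anc WnodeE.
Qed.

Lemma DextE s : Dext k s = (Dnode k s).+1 + \sum_(1 <= j < k | spine k j (keys s)) 1.
Proof.
rewrite /Dext /depth external_nodeE -size_gap_path gap_pathE ?keys_uniq //.
by rewrite -sum1_size (sum_keys s) sum_gap_anc DnodeE.
Qed.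

End Keys.

(** * Exchanging two keys *)

(** The exchange of [a] and [b], as a function on keys. *)
Definition swap (a b x : nat) := if x == a then b else if x == b then a else x.

Lemma swapK a b : involutive (swap a b).
Proof. by move=> x; rewrite /swap; do ?case: ifP; lia. Qed.

Lemma keys_tperm n (s : 'S_n) (i j : 'I_n) :
  keys (s * tperm i j)%g = map (swap i.+1 j.+1) (keys s).
Proof.
rewrite /keys -map_comp; apply: eq_map => l /=; rewrite permM /swap !eqSS.
case: tpermP => [->|->|/eqP/negPf li /eqP/negPf lj].
- by rewrite eqxx.
- by case: eqP => [->|_]; rewrite ?eqxx.
- by rewrite -!val_eqE /= in li lj; rewrite li lj.
Qed.

Lemma first_swap a b x y s : a <= x <= b -> a <= y <= b ->
  first a b (map (swap x y) s) = omap (swap x y) (first a b s).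
Proof.
move=> xab yab; rewrite /first filter_map.
rewrite (eq_filter (a2 := fun z => a <= z <= b)); first by case: seq.filter.
by move=> z /=; rewrite /swap; do ?case: ifP; lia.
Qed.

Lemma first_swap_eq a b x y u s : a <= x <= b -> a <= y <= b ->
  (first a b (map (swap x y) s) == Some u) = (first a b s == Some (swap x y u)).
Proof.
move=> xab yab; rewrite first_swap //.
by case: first => [v|] //=; apply/eqP/eqP => [[<-]|[->]]; rewrite swapK.
Qed.

Lemma first_keys n (s : 'S_n) a b : 1 <= a <= b -> b <= n ->
  exists2 v, a <= v <= b & first a b (keys s) = Some v.
Proof.
move=> ab bn; rewrite /first.
have : a \in [seq x <- keys s | a <= x <= b] by rewrite mem_filter mem_keys; lia.
case E: seq.filter => [//|v t] _; exists v => //.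
have : v \in [seq x <- keys s | a <= x <= b] by rewrite E inE eqxx.
by rewrite mem_filter => /andP[].
Qed.

Lemma first_sub a b c d u s : c <= a -> b <= d -> a <= u <= b ->
  first c d s = Some u -> first a b s = Some u.
Proof.
move=> ca bd uab; elim: s => // x s IHs; rewrite !first_cons.
case: ifP => [_ [->]|xcd]; first by rewrite uab.
by rewrite ifF //; move: xcd; lia.
Qed.

Local Open Scope ring_scope.

(** * Expectations and probabilities under a uniform permutation *)

Section Expectation.
Variables (R : realType) (n : nat).
Implicit Types (X Y : 'S_n -> R) (G H : seq nat -> bool).

Lemma card_perm_gt0 : 0 < #|{: 'S_n}|%:R :> R.
Proof. by rewrite ltr0n; apply/card_gt0P; exists 1%g. Qed.

Lemma eq_Eperm X Y : X =1 Y -> Eperm X = Eperm Y.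
Proof. by move=> XY; congr (_ / _); apply: eq_bigr => s _. Qed.

Lemma EpermD X Y : Eperm (fun s => X s + Y s) = Eperm X + Eperm Y.
Proof. by rewrite /Eperm big_split mulrDl. Qed.

Lemma EpermZ a X : Eperm (fun s => a * X s) = a * Eperm X.
Proof. by rewrite /Eperm -mulr_sumr mulrA. Qed.

Lemma Eperm_cst (a : R) : Eperm (fun _ : 'S_n => a) = a.
Proof.
apply: (canLR (mulfK (lt0r_neq0 card_perm_gt0))).
by rewrite sumr_const mulr_natr.
Qed.

Lemma Eperm_sum (I : Type) (r : seq I) (P : pred I) (X : I -> 'S_n -> R) :
  Eperm (fun s => \sum_(i <- r | P i) X i s) = \sum_(i <- r | P i) Eperm (X i).
Proof. by rewrite /Eperm exchange_big mulr_suml. Qed.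

Lemma ler_Eperm X Y : (forall s, X s <= Y s) -> Eperm X <= Eperm Y.
Proof.
by move=> XY; rewrite ler_wpM2r ?invr_ge0 ?ler0n //; apply: ler_sum => s _.
Qed.

Lemma Eperm_ge0 X : (forall s, 0 <= X s) -> 0 <= Eperm X.
Proof. by move=> X0; rewrite -(Eperm_cst 0); apply: ler_Eperm. Qed.

Lemma VarpermE X : Varperm X = Eperm (fun s => X s ^+ 2) - Eperm X ^+ 2.
Proof.
rewrite /Varperm; set m := Eperm X.
rewrite (@eq_Eperm _ (fun s => X s ^+ 2 + (- (2 * m) * X s + m ^+ 2))); last first.
  by move=> s /=; ring.
by rewrite !EpermD EpermZ Eperm_cst -/m; ring.
Qed.

(** Exchanging two keys preserves the uniform distribution. *)
Lemma Eperm_swap a b (X : seq nat -> R) : (1 <= a <= n)%N -> (1 <= b <= n)%N ->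
  Eperm (fun s : 'S_n => X (map (swap a b) (keys s))) =
  Eperm (fun s : 'S_n => X (keys s)).
Proof.
case: a b => [|a] [|b] //= an bn; congr (_ / _).
rewrite [RHS](reindex_inj (mulIg (tperm (Ordinal an) (Ordinal bn)))) /=.
by apply: eq_bigr => s _; rewrite keys_tperm.
Qed.

(** The probability that the random list of keys satisfies [G]. *)
Definition prob (G : seq nat -> bool) : R :=
  Eperm (fun s : 'S_n => (G (keys s))%:R).

Lemma prob_true : prob (fun=> true) = 1.
Proof. exact: Eperm_cst. Qed.

Lemma eq_prob G H : G =1 H -> prob G = prob H.
Proof. by move=> GH; apply: eq_Eperm => s; rewrite GH. Qed.

Lemma ler_prob G H : (forall s, G s -> H s) -> prob G <= prob H.
Proof.
move=> GH; apply: ler_Eperm => s; rewrite ler_nat.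
by case: (G _) (GH (keys s)) => // ->.
Qed.

(** [G] is not affected by the exchange of two keys of [a, b]. *)
Definition swap_invariant a b (G : seq nat -> bool) := forall x y s,
  (a <= x <= b)%N -> (a <= y <= b)%N -> G (map (swap x y) s) = G s.

(** Exchanging [u] with [v] shows that the events that [G] holds and [v] comes
first in [a, b] have the same probability for all [v] of [a, b]; these events
partition [G]. *)
Lemma prob_first (G : seq nat -> bool) a b u :
  (1 <= a)%N -> (a <= u <= b)%N -> (b <= n)%N -> swap_invariant a b G ->
  prob (fun s => G s && (first a b s == Some u)) = prob G / (b - a).+1%:R.
Proof.
move=> a1 uab bn Ginv; set p := fun v => prob (fun s => G s && (first a b s == Some v)).
have pE v : (a <= v < b.+1)%N -> p v = p u.
  move=> vab.
  have un : (1 <= u <= n)%N by lia.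
  have vn : (1 <= v <= n)%N by lia.
  have -> : p v = Eperm (fun s : 'S_n => (G (map (swap u v) (keys s)) &&
      (first a b (map (swap u v) (keys s)) == Some v))%:R).
    exact: esym (Eperm_swap (fun t => (G t && (first a b t == Some v))%:R) un vn).
  apply: eq_Eperm => s /=; rewrite Ginv ?first_swap_eq; try lia.
  by rewrite /swap eqxx; case: (eqVneq v u) => [->|].
have : \sum_(a <= v < b.+1) p v = prob G.
  rewrite -Eperm_sum; apply: eq_Eperm => s /=.
  have [|w wab ->] := @first_keys _ s a b _ bn; first by lia.
  rewrite (bigD1_seq w) ?mem_index_iota ?iota_uniq //= eqxx andbT.
  rewrite big1 ?addr0 // => v /negPf vw.
  by case: eqP => [[wv]|_]; rewrite ?andbF //; move: vw; rewrite wv eqxx.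
rewrite (eq_big_nat _ _ pE) sumr_const_nat => <-; rewrite -/(p u).
rewrite subSn; last by lia.
by rewrite -[X in _ = X / _]mulr_natr mulfK // pnatr_eq0.
Qed.

Lemma swap_invariant_first a b c d w : (c <= a)%N -> (b <= d)%N ->
  ~~ (a <= w <= b)%N -> swap_invariant a b (fun s => first c d s == Some w).
Proof.
move=> ca bd wab x y s xab yab; rewrite first_swap_eq; try lia.
by congr (_ == Some _); rewrite /swap; do ?case: ifP; lia.
Qed.

Lemma prob_first1 a b u : (1 <= a)%N -> (a <= u <= b)%N -> (b <= n)%N ->
  prob (fun s => first a b s == Some u) = (b - a).+1%:R^-1.
Proof.
by move=> a1 uab bn; rewrite (@prob_first xpredT) // prob_true mul1r.
Qed.

Lemma prob_first2 a b u c d w : (1 <= c)%N -> (c <= a)%N -> (b <= d)%N -> (d <= n)%N ->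
  (a <= u <= b)%N -> (c <= w <= d)%N -> ~~ (a <= w <= b)%N ->
  prob (fun s => (first c d s == Some w) && (first a b s == Some u)) =
  (d - c).+1%:R^-1 / (b - a).+1%:R.
Proof.
move=> c1 ca bd dn uab wcd wab.
rewrite (prob_first _ uab); try lia; last exact: swap_invariant_first.
by rewrite prob_first1.
Qed.

End Expectation.

(** * Covariances of the ancestor indicators *)

Section Moments.
Variables (R : realType) (n k : nat).
Hypothesis kn : (1 <= k <= n)%N.

Lemma prob_anc j : (1 <= j <= n)%N ->
  prob R n (anc k j) = (maxn j k - minn j k).+1%:R^-1.
Proof. by move=> jn; apply: prob_first1; lia. Qed.

(** Any two ancestor indicators are nonnegatively correlated.  On the same side
of [k] they are independent.  If [i < k < j], both hold in particular when [i]
comes first in [i, j] and [j] in [k, j], and when [j] comes first in [i, j] and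
[i] in [i, k]; with a = k - i and b = j - k, these two disjoint events have total
probability (1/(a+1) + 1/(b+1))/(a+b+1), which is at least 1/((a+1)(b+1)). *)
Lemma prob_anc_pair i j : (1 <= i)%N -> (i < j)%N -> (j <= n)%N ->
  prob R n (anc k i) * prob R n (anc k j) <= prob R n (fun s => anc k i s && anc k j s).
Proof.
move=> i1 ij jn; rewrite !prob_anc; try lia.
case: (leqP k i) => ki.
  rewrite (@eq_prob _ _ _ (fun s => (first k j s == Some j) && (first k i s == Some i))).
    rewrite prob_first2; try lia.
    by rewrite le_eqVlt mulrC; apply/orP; left; apply/eqP; congr (_%:R^-1 * _%:R^-1); lia.
  move=> s /=; rewrite andbC /anc.
  have [-> ->] : minn j k = k /\ maxn j k = j by lia.
  by have [-> ->] : minn i k = k /\ maxn i k = i by lia.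
case: (leqP j k) => jk.
  rewrite (@eq_prob _ _ _ (fun s => (first i k s == Some i) && (first j k s == Some j))).
    rewrite prob_first2; try lia.
    by rewrite le_eqVlt; apply/orP; left; apply/eqP; congr (_%:R^-1 * _%:R^-1); lia.
  move=> s /=; rewrite /anc.
  have [-> ->] : minn j k = j /\ maxn j k = k by lia.
  by have [-> ->] : minn i k = i /\ maxn i k = k by lia.
pose G s := (first i j s == Some i) && (first k j s == Some j).
pose H s := (first i j s == Some j) && (first i k s == Some i).
have GH : prob R n G + prob R n H <= prob R n (fun s => anc k i s && anc k j s).
  rewrite /prob -EpermD; apply: ler_Eperm => s; rewrite -natrD ler_nat /G /H /anc.
  have [-> ->] : minn j k = k /\ maxn j k = j by lia.
  have [-> ->] : minn i k = i /\ maxn i k = k by lia.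
  have [v vij Ev] : exists2 v, (i <= v <= j)%N & first i j (keys s) = Some v.
    by apply: first_keys; lia.
  have eqS (a b : nat) : (Some a == Some b) = (a == b).
    by apply/eqP/eqP => [[]|->].
  rewrite Ev !eqS; case: (eqVneq v i) => [vi|_].
    have /negPf -> : v != j by lia.
    have Ei := etrans Ev (congr1 _ vi).
    by rewrite addn0 (first_sub (a := i) (b := k) (u := i) _ _ _ Ei) ?eqxx //; lia.
  case: (eqVneq v j) => [vj|_] //.
  have Ej := etrans Ev (congr1 _ vj).
  by rewrite (first_sub (a := k) (b := j) (u := j) _ _ _ Ej) ?eqxx ?andbT //; lia.
apply: le_trans GH; rewrite /G /H !prob_first2; try lia.
have -> : (j - i)%N = (k - i + (j - k))%N by lia.
set a := (k - i)%N; set b := (j - k)%N.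
have a0 : 0 <= a%:R :> R by []. have b0 : 0 <= b%:R :> R by [].
rewrite -!natr1 natrD.
move: a0 b0; set x := a%:R; set y := b%:R => x0 y0.
rewrite -subr_ge0 [X in 0 <= X](_ : _ = ((x + 1) * (y + 1) * (x + y + 1))^-1).
  by rewrite invr_ge0 !mulr_ge0 // ?addr_ge0.
by field; rewrite !gt_eqF //; lra.
Qed.

(** A nonnegative combination of pairwise nonnegatively correlated indicators
has at least the variance that it would have if they were uncorrelated. *)
Lemma Varperm_sum_ge (a : nat -> R) (Z : nat -> seq nat -> bool) :
  (forall j, 0 <= a j) ->
  (forall i j, (1 <= i)%N -> (i < j)%N -> (j <= n)%N ->
     prob R n (Z i) * prob R n (Z j) <= prob R n (fun s => Z i s && Z j s)) ->
  \sum_(1 <= j < n.+1) a j ^+ 2 * (prob R n (Z j) - prob R n (Z j) ^+ 2) <=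
  Varperm (fun s : 'S_n => \sum_(1 <= j < n.+1) a j * (Z j (keys s))%:R).
Proof.
move=> a0 Zcov; pose p j := prob R n (Z j).
pose c i j := prob R n (fun s => Z i s && Z j s) - p i * p j.
have cC i j : c i j = c j i.
  by rewrite /c mulrC; congr (_ - _); apply: eq_prob => s; rewrite andbC.
have c0 i j : (1 <= i <= n)%N -> (1 <= j <= n)%N -> i != j -> 0 <= c i j.
  move=> i1 j1; rewrite neq_ltn => /orP[ij|ij]; last rewrite cC.
    by rewrite subr_ge0; apply: Zcov; lia.
  by rewrite subr_ge0; apply: Zcov; lia.
have -> : Varperm (fun s : 'S_n => \sum_(1 <= j < n.+1) a j * (Z j (keys s))%:R) =
    \sum_(1 <= i < n.+1) \sum_(1 <= j < n.+1) a i * a j * c i j.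
  rewrite VarpermE Eperm_sum expr2 big_distrlr /=.
  under eq_Eperm do rewrite expr2 big_distrlr /=.
  rewrite Eperm_sum -sumrB; apply: eq_bigr => i _.
  rewrite Eperm_sum -sumrB; apply: eq_bigr => j _.
  rewrite !EpermZ -/(prob R n (Z i)) -/(prob R n (Z j)) -/(p i) -/(p j).
  rewrite (@eq_Eperm _ _ _ (fun s => a i * a j * (Z i (keys s) && Z j (keys s))%:R)).
    by rewrite EpermZ /c /prob; ring.
  by move=> s; case: (Z i _); case: (Z j _) => /=; ring.
apply: ler_sum_nat => i i1.
rewrite (bigD1_seq i) ?mem_index_iota ?iota_uniq //=.
have -> : a i * a i * c i i = a i ^+ 2 * (prob R n (Z i) - prob R n (Z i) ^+ 2).
  rewrite /c /p -!expr2; congr (_ * (_ - _)).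
  by apply: eq_prob => s; rewrite andbb.
rewrite lerDl big_seq_cond; apply: sumr_ge0 => j; rewrite mem_index_iota => /andP[j1 ji].
by rewrite mulr_ge0 ?mulr_ge0 // c0 // eq_sym.
Qed.

(** * Second moment of the spine *)

(** The number of keys at distance at most [e] below [k] on the right spine of
the left subtree of [k]; the index [d] stands for the distance [d.+1]. *)
Definition spine_count (e : nat) (s : seq nat) : nat :=
  \sum_(0 <= d < e) spine k (k - d.+1) s.

Lemma prob_spine d : (d.+1 < k)%N ->
  prob R n (spine k (k - d.+1)) = (d.+2%:R * d.+1%:R)^-1.
Proof.
move=> dk; rewrite /spine prob_first2; try lia.
by rewrite invfM; congr (_%:R^-1 / _%:R); lia.
Qed.

Lemma prob_spine_pair d e : (d < e)%N -> (e.+1 < k)%N ->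
  prob R n (fun s => spine k (k - e.+1) s && spine k (k - d.+1) s) <=
  (e.+2%:R * e.+1%:R)^-1 / d.+1%:R.
Proof.
move=> de ek; pose G s := spine k (k - e.+1) s.
apply: (@le_trans _ _ (prob R n
  (fun s => G s && (first (k - d.+1) k.-1 s == Some (k - d.+1)%N)))).
  by apply: ler_prob => s /andP[Ge /andP[_ De]]; rewrite /G Ge De.
rewrite prob_first; try lia.
  rewrite prob_spine //.
  by have -> : ((k.-1 - (k - d.+1)).+1 = d.+1)%N by lia.
move=> x y s xab yab; rewrite /G /spine.
by congr (_ && _); apply: (@swap_invariant_first (k - d.+1) k.-1); lia.
Qed.

(** Adding the distance [e.+1] to [spine_count e] increases the second moment
by at most (1 + 2 H_e)/((e+1)(e+2)), which is exactly the increment of the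
bound; here [series harmonic e] is H_e = 1 + 1/2 + ... + 1/e. *)
Lemma spine_count_moment e : (e < k)%N ->
  Eperm (fun s : 'S_n => (spine_count e (keys s))%:R ^+ 2 : R) <=
  3 - (3 + 2 * series harmonic e) / e.+1%:R.
Proof.
elim: e => [|e IHe] ek.
  rewrite (@eq_Eperm _ _ _ (fun=> 0)) ?Eperm_cst; last first.
    by move=> s; rewrite /spine_count big_geq // expr0n.
  by rewrite /series /= big_geq // mulr0 addr0 divr1 subrr.
pose S (d : nat) (s : 'S_n) : bool := spine k (k - d.+1) (keys s).
rewrite (@eq_Eperm _ _ _ (fun s => (spine_count e (keys s))%:R ^+ 2 +
    ((S e s)%:R + 2 * \sum_(0 <= d < e) (S e s && S d s)%:R))); last first.
  move=> s; rewrite /spine_count big_nat_recr //= natrD -/(S e s).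
  rewrite sqrrD -addrA; congr (_ + _); rewrite addrC; congr (_ + _).
    by case: S; rewrite ?expr1n ?expr0n.
  rewrite -mulr_natl; congr (_ * _); rewrite natr_sum mulr_suml.
  by apply: eq_bigr => d _; rewrite -natrM mulnb andbC.
rewrite !EpermD EpermZ Eperm_sum.
have /IHe IH : (e < k)%N by lia.
have P1 : Eperm (fun s => (S e s)%:R : R) = (e.+2%:R * e.+1%:R)^-1 by apply: prob_spine.
have P2 : \sum_(0 <= d < e) Eperm (fun s => (S e s && S d s)%:R : R) <=
    (e.+2%:R * e.+1%:R)^-1 * series harmonic e.
  rewrite /series /= mulr_sumr; apply: ler_sum_nat => d /andP[_ de].
  exact: prob_spine_pair.
rewrite P1; move: P2 IH.
set E1 := Eperm _; set E2 := \sum_(0 <= d < e) Eperm _ => P2 IH.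
have -> : series harmonic e.+1 = series harmonic e + e.+1%:R^-1 :> R.
  by rewrite /series /= big_nat_recr.
set H := series _ _ in P2 IH *.
have e0 : 0 <= e%:R :> R by [].
rewrite -[e.+2%:R]natr1 -[e.+1%:R]natr1 in P2 IH *; set x := e%:R in e0 P2 IH *.
apply: le_trans (lerD IH (lerD (lexx _) (ler_wpM2l (ler0n _ 2) P2))) _.
rewrite le_eqVlt; apply/orP; left; apply/eqP.
by field; rewrite !gt_eqF //; lra.
Qed.

Lemma spine_count_moment_le3 :
  Eperm (fun s : 'S_n => (spine_count k.-1 (keys s))%:R ^+ 2 : R) <= 3.
Proof.
apply: le_trans (spine_count_moment (_ : k.-1 < k)%N) _; first by lia.
rewrite lerBlDr lerDl divr_ge0 // addr_ge0 // mulr_ge0 //.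
by apply: sumr_ge0 => i _; apply: harmonic_ge0.
Qed.

(** * Bounds on the differences and on the variance *)

Lemma spine_sumE (f : nat -> nat) s :
  (\sum_(1 <= j < k | spine k j s) f j =
   \sum_(0 <= d < k.-1) f (k - d.+1) * spine k (k - d.+1) s)%N.
Proof.
rewrite big_mkcond big_nat_rev big_add1 /=; apply: eq_big_nat => d dk.
rewrite add1n subSS; case: spine; first by rewrite muln1.
by rewrite muln0.
Qed.

Lemma Dext_sub_Dnode (s : 'S_n) :
  Dext k s = (Dnode k s + (1 + spine_count k.-1 (keys s)))%N.
Proof.
rewrite DextE // spine_sumE addnA addn1; congr addn.
by apply: eq_bigr => d _; rewrite mul1n.
Qed.

Lemma Wext_sub_Wnode (s : 'S_n) : exists2 x,
  Wext k s = (Wnode k s + x)%N & (x <= k * spine_count k.-1 (keys s))%N.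
Proof.
rewrite WextE // spine_sumE; eexists; first by [].
rewrite /spine_count big_distrr /=; apply: leq_sum => d _.
by rewrite leq_mul2r leq_subr orbT.
Qed.

Lemma Eperm_depth_diff :
  Eperm (fun s : 'S_n => `|(Dnode k s)%:R - (Dext k s)%:R| ^+ 2 : R) <= 8.
Proof.
apply: le_trans (_ : Eperm (fun s : 'S_n =>
   2 + 2 * (spine_count k.-1 (keys s))%:R ^+ 2 : R) <= _).
  apply: ler_Eperm => s; rewrite Dext_sub_Dnode real_normK ?num_real //.
  rewrite !natrD; set x := (spine_count _ _)%:R.
  rewrite -subr_ge0 [X in 0 <= X](_ : _ = (x - 1) ^+ 2) ?sqr_ge0 //; ring.
rewrite EpermD EpermZ Eperm_cst; have := spine_count_moment_le3; lra.
Qed.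

Lemma Eperm_wdepth_diff :
  Eperm (fun s : 'S_n => `|(Wnode k s)%:R - (Wext k s)%:R| ^+ 2 : R) <= 3 * k%:R ^+ 2.
Proof.
apply: le_trans (_ : Eperm (fun s : 'S_n =>
   k%:R ^+ 2 * (spine_count k.-1 (keys s))%:R ^+ 2 : R) <= _).
  apply: ler_Eperm => s; have [x -> xk] := Wext_sub_Wnode s.
  rewrite real_normK ?num_real // natrD opprD addNKr sqrrN -exprMn -natrM.
  by rewrite ler_sqr ?nnegrE ?ler0n // ler_nat.
by rewrite EpermZ mulrC ler_wpM2r ?sqr_ge0 // spine_count_moment_le3.
Qed.

Lemma Var_anc_ge :
  k%:R ^+ 2 / 8 * (\sum_(0 <= b < n %/ 4) b.+2%:R^-1) <=
  Varperm (fun s : 'S_n => (Wnode k s)%:R : R).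
Proof.
pose t j := (j%:R ^+ 2 * (prob R n (anc k j) - prob R n (anc k j) ^+ 2) : R).
have t0 j : (1 <= j <= n)%N -> 0 <= t j.
  move=> jn; rewrite /t prob_anc // mulr_ge0 ?sqr_ge0 // subr_ge0.
  rewrite expr2 ler_piMr ?invr_ge0 ?ler0n //.
  by rewrite invf_le1 ?ltr0n // ler1n.
(* The contribution of one key at distance b + 1 from k; its indicator has
   variance (b+1)/(b+2)^2, which is at least 1/(2(b+2)). *)
have tk b j : (1 <= j <= n)%N -> (k <= 2 * j)%N -> (maxn j k - minn j k = b.+1)%N ->
    k%:R ^+ 2 / 8 * b.+2%:R^-1 <= t j.
  move=> jn kj jkb; rewrite /t prob_anc // jkb.
  have kj' : k%:R <= 2 * j%:R :> R by rewrite -natrM ler_nat.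
  have : k%:R ^+ 2 / 4 <= j%:R ^+ 2 :> R.
    rewrite ler_pdivrMr //; apply: le_trans (_ : (2 * j%:R) ^+ 2 <= _).
      by rewrite ler_sqr ?nnegrE ?mulr_ge0.
    by have -> : (2 * j%:R) ^+ 2 = j%:R ^+ 2 * 4 :> R by ring.
  have : b.+2%:R^-1 / 2 <= b.+2%:R^-1 - b.+2%:R^-1 ^+ 2 :> R.
    have b0 : 0 <= b%:R :> R by [].
    rewrite -subr_ge0 -[b.+2%:R]natr1 -[b.+1%:R]natr1 [X in 0 <= X](_ : _ =
       b%:R / (2 * (b%:R + 1 + 1) ^+ 2)); last by field; rewrite gt_eqF //; lra.
    by rewrite divr_ge0 // mulr_ge0 // sqr_ge0.
  move=> h1 h2.
  have -> : k%:R ^+ 2 / 8 * b.+2%:R^-1 = k%:R ^+ 2 / 4 * (b.+2%:R^-1 / 2) :> R.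
    by move: (b.+2%:R^-1 : R) => z; field.
  by apply: ler_pM => //; rewrite ?divr_ge0 ?sqr_ge0 ?invr_ge0.
apply: le_trans (_ : \sum_(1 <= j < n.+1) t j <= _); last first.
  rewrite (_ : (fun s => _) = fun s : 'S_n =>
      \sum_(1 <= j < n.+1) j%:R * (anc k j (keys s))%:R).
    by apply: Varperm_sum_ge => // i j; exact: prob_anc_pair.
  apply/funext => s; rewrite WnodeE // natr_sum big_mkcond; apply: eq_bigr => j _.
  by case: anc; rewrite ?mulr1 ?mulr0.
have sub u v : (1 <= u)%N -> (v <= n.+1)%N ->
    \sum_(u <= j < v) t j <= \sum_(1 <= j < n.+1) t j.
  move=> u1 vn; rewrite (big_nat_widen _ _ n.+1) // (big_nat_widenl _ 1%N) //.
  rewrite big_mkcond; apply: ler_sum_nat => j jn.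
  by case: ifP => // _; apply: t0; lia.
have shift u v (G : nat -> R) :
    \sum_(u <= j < v) G j = \sum_(0 <= b < v - u) G (b + u)%N.
  by rewrite -{1}[u]add0n big_addn.
(* The n/4 keys next to k are taken above k when 2k <= n, and below k
   otherwise; in both cases they lie in [k/2, n]. *)
rewrite mulr_sumr; case: (leqP (2 * k) n) => kn2.
  apply: le_trans (sub (k.+1) (k.+1 + n %/ 4)%N _ _); try lia.
  rewrite shift addKn; apply: ler_sum_nat => b bn.
  by apply: tk; lia.
apply: le_trans (sub (k - n %/ 4)%N k _ _); try lia.
rewrite big_nat_rev shift.
have -> : (k - (k - n %/ 4) = n %/ 4)%N by lia.
by apply: ler_sum_nat => b bn; apply: tk; lia.
Qed.

End Moments.

(** * Asymptotics *)

Lemma harmonic_tail_unbounded (R : realType) (K : R) : exists M : nat, forall m,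
  (M <= m)%N -> K <= \sum_(0 <= b < m) b.+2%:R^-1.
Proof.
have := @dvg_harmonic R => /(nondecreasing_dvgn_lt _).
move=> /(_ _)/cvgryPge/(_ (K + 1)) [|M _ HM].
  apply/nondecreasing_seqP => m; rewrite /series /= big_nat_recr //= lerDl.
  exact: harmonic_ge0.
exists M => m Mm; have /HM : (M <= m.+1)%N by lia.
by rewrite /= /series /= big_nat_recl //= invr1 addrC lerD2l.
Qed.

Theorem mainTheorem6 (R : realType) :
  unif_littleo
    (fun n k => Eperm (fun s : 'S_n =>
       `| (Dnode k s)%:R - (Dext k s)%:R | ^+ 2 : R))
    (fun n _ => ln (n%:R : R))
  /\
  unif_littleo
    (fun n k => Eperm (fun s : 'S_n =>
       `| (Wnode k s)%:R - (Wext k s)%:R | ^+ 2 : R))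
    (fun n k => Varperm (fun s : 'S_n => (Wnode k s)%:R : R)).
Proof.
split=> eps eps0.
  have /archi_boundP := expR_ge0 (8 / eps); set N := Num.Def.archi_bound _ => HN.
  exists N => n k Nn kn; rewrite ger0_norm; last by apply: Eperm_ge0 => s; rewrite exprn_ge0.
  apply: le_trans (Eperm_depth_diff R kn) _.
  have n0 : 0 < n%:R :> R by rewrite ltr0n; lia.
  have : 8 / eps <= ln (n%:R : R).
    rewrite -[X in X <= _]expRK ler_ln ?posrE ?expR_gt0 //.
    by apply: le_trans (ltW HN) _; rewrite ler_nat.
  rewrite ler_pdivrMr // mulrC => /le_trans; apply.
  by rewrite ler_pM2l // ler_norm.
(* 24 = 3 * 8: the moment bound is 3 k^2, the variance bound k^2/8 times the
   harmonic sum. *)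
have [M HM] := harmonic_tail_unbounded (24 / eps).
exists (4 * M)%N => n k Nn kn.
rewrite ger0_norm; last by apply: Eperm_ge0 => s; rewrite exprn_ge0.
apply: le_trans (Eperm_wdepth_diff R kn) _.
have /HM : (M <= n %/ 4)%N by lia.
rewrite ler_pdivrMr // => H.
apply: le_trans (_ : eps * (k%:R ^+ 2 / 8 * \sum_(0 <= b < n %/ 4) b.+2%:R^-1) <= _).
  move: H; set S := \sum_(_ <= _ < _) _ => H.
  have := ler_wpM2l (sqr_ge0 (k%:R : R)) H; lra.
rewrite ler_pM2l //; apply: le_trans (ler_norm _); exact: Var_anc_ge.
Qed.
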